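(* Let $\mathcal M_V=(\Sigma_V,\preccurlyeq_{\Sigma_V},s_{\Sigma_V})$ and $\mathcal M_E=(\Sigma_E,\preccurlyeq_{\Sigma_E},s_{\Sigma_E})$ be Maximum Common Subelement (MCS) Models whose size functions are strictly positive ($s_{\Sigma_V}>0$, $s_{\Sigma_E}>0$). Let $G$ be the set of graphs with vertex labels in $\Sigma_V$ and edge labels in $\Sigma_E$, where isomorphic graphs are regarded as the same element of $G$. Let $\subseteq_e$ be the extended-subgraph-isomorphic relation on $G$ with respect to $\preccurlyeq_{\Sigma_V}$ and $\preccurlyeq_{\Sigma_E}$, and define $s_{GES}:G\to[0,\infty)$ by $s_{GES}(g)=0$ if $V=\emptyset$ and otherwise $s_{GES}(g)=\sum_{v\in V}s_{\Sigma_V}(\ell_V(v))+\sum_{e\in E}s_{\Sigma_E}(\ell_E(e))$ for $g=(V,E,\ell_V,\ell_E)$. Then $(G,\subseteq_e,s_{GES})$ is an MCS Model.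
   Context: A graph is a 4-tuple $g=(V,E,\ell_V,\ell_E)$ with $V$ a finite set, $E\subseteq[V]^2$ (the set of 2-element subsets of $V$), $\ell_V:V\to\Sigma_V$, $\ell_E:E\to\Sigma_E$; it is empty if $V=\emptyset$. An isomorphism between $g_1$ and $g_2$ is a bijection $\phi:V_1\to V_2$ with $E_2=\{\{\phi(u),\phi(v)\}:\{u,v\}\in E_1\}$, $\ell_{V_1}(v)=\ell_{V_2}(\phi(v))$ and $\ell_{E_1}(\{u,v\})=\ell_{E_2}(\{\phi(u),\phi(v)\})$. $g'=(V',E',\ell'_V,\ell'_E)$ is an extended subgraph of $g=(V,E,\ell_V,\ell_E)$ (w.r.t. $\preccurlyeq_{\Sigma_V},\preccurlyeq_{\Sigma_E}$) if $V'\subseteq V$, $E'\subseteq E\cap[V']^2$, $\ell'_V(v)\preccurlyeq_{\Sigma_V}\ell_V(v)$ for $v\in V'$ and $\ell'_E(e)\preccurlyeq_{\Sigma_E}\ell_E(e)$ for $e\in E'$. $g'\subseteq_e g$ means $g'$ is isomorphic to some extended subgraph of $g$. For a partial order $\preccurlyeq$ on $X$ and $X'\subseteq X$, $cs(X')=\{x\in X: x\preccurlyeq y\ \forall y\in X'\}$. A size function on $(X,\preccurlyeq)$ is $s:X\to[0,\infty)$ with (S1) $x_1\preccurlyeq x_2\Rightarrow s(x_1)\le s(x_2)$ and (S2) $x_1\preccurlyeq x_2$, $s(x_1)=s(x_2)\Rightarrow x_1=x_2$. An MCS Model is a triple $(X,\preccurlyeq,s)$ with $\preccurlyeq$ a partial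 order on $X$, $s$ a size function, and (A1) for all $x_1,x_2$, $cs(\{x_1,x_2\})\ne\emptyset$ and $\{s(x)\mid x\in cs(\{x_1,x_2\})\}$ has a maximum; (A2) for all $x_1,x_2,x$ with $x_1,x_2\preccurlyeq x$ there is $x_{12}\in cs(\{x_1,x_2\})$ with $s(x)\ge s(x_1)+s(x_2)-s(x_{12})$. *)

(* Defs.v *)
From HB Require Import structures.
From mathcomp Require Import all_boot all_order all_algebra.
From mathcomp Require Import finmap generic_quotient.
From mathcomp Require Import boolp classical_sets reals.
From Stdlib Require Relation_Definitions.

Set Implicit Arguments.
Unset Strict Implicit.
Unset Printing Implicit Defensive.

Import Order.TTheory GRing.Theory Num.Theory.

Local Open Scope ring_scope.
Local Open Scope quotient_scope.

Section MCSModel.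
Local Open Scope classical_set_scope.
Context {R : realType} {X : Type}.
Implicit Types (le : X -> X -> Prop) (s : X -> R).

Definition cs le (A : set X) : set X := [set x | forall y, A y -> le x y].

Definition has_maximum (A : set R) : Prop := exists2 m, A m & ubound A m.

Record size_function le s : Prop := SizeFunction {
  size_ge0 : forall x, 0 <= s x;
  size_le : forall x1 x2, le x1 x2 -> s x1 <= s x2;
  size_inj : forall x1 x2, le x1 x2 -> s x1 = s x2 -> x1 = x2
}.

Record mcs_model le s : Prop := MCSModel {
  mcs_order : Relation_Definitions.order X le;
  mcs_size : size_function le s;
  mcs_max : forall x1 x2,
    cs le [set x1; x2] !=set0 /\
    has_maximum [set s x | x in cs le [set x1; x2]];
  mcs_amalgam : forall x1 x2 x, le x1 x -> le x2 x ->
    exists2 x12, cs le [set x1; x2] x12 & s x1 + s x2 - s x12 <= s x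
}.

End MCSModel.

Section Graphs.
Local Open Scope fset_scope.
Context {T : choiceType}.

(* [V]^2 *)
Definition pairs (V : {fset T}) : {fset {fset T}} :=
  [fset e in fpowerset V | #|` e| == 2%N].

(* Vertices are taken from an ambient type T. When T is infinite, every finite
   graph occurs up to isomorphism. The labels are defined on the vertices and
   on the edges only, so that the label types may be empty. *)
Record lgraph (SV SE : Type) := LGraph {
  verts : {fset T};
  edges : {fset {fset T}};
  edges_pairs : edges `<=` pairs verts;
  vlab : verts -> SV;
  elab : edges -> SE
}.

Context {SV SE : Type}.
Implicit Types g h : lgraph SV SE.

HB.instance Definition _ := gen_eqMixin (lgraph SV SE).
HB.instance Definition _ := gen_choiceMixin (lgraph SV SE).

Definition pair_of {V : {fset T}} (u v : V) : {fset T} := [fset val u; val v].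

Definition is_iso g1 g2 (phi : verts g1 -> verts g2) : Prop :=
  [/\ bijective phi,
      [set` edges g2]%classic =
        [set e | exists u v : verts g1,
           pair_of u v \in edges g1 /\ e = pair_of (phi u) (phi v)]%classic,
      forall v, vlab v = vlab (phi v) &
      forall u v (uv1 : pair_of u v \in edges g1)
        (uv2 : pair_of (phi u) (phi v) \in edges g2),
        elab [` uv1] = elab [` uv2]].

Definition isomorphic g1 g2 : Prop := exists phi, is_iso (g1 := g1) (g2 := g2) phi.

Section ExtendedSubgraph.
Variables (leV : SV -> SV -> Prop) (leE : SE -> SE -> Prop).

Definition extended_subgraph g' g : Prop :=
  [/\ verts g' `<=` verts g,
      edges g' `<=` edges g `&` pairs (verts g'),
      forall v (vg' : v \in verts g') (vg : v \in verts g),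
        leV (vlab [` vg']) (vlab [` vg]) &
      forall e (eg' : e \in edges g') (eg : e \in edges g),
        leE (elab [` eg']) (elab [` eg])].

Definition ext_sub_iso g' g : Prop :=
  exists2 h, isomorphic g' h & extended_subgraph h g.

End ExtendedSubgraph.

Definition graph_size {R : realType} (sV : SV -> R) (sE : SE -> R) g : R :=
  if verts g == fset0 then 0
  else (\sum_(v : verts g) sV (vlab v) + \sum_(e : edges g) sE (elab e))%R.

Lemma pair_ofC (V : {fset T}) (u v : V) : pair_of u v = pair_of v u.
Proof. exact: fsetUC. Qed.

Lemma pair_of_inj (V : {fset T}) (u v u' v' : V) : pair_of u v = pair_of u' v' ->
  (u = u' /\ v = v') \/ (u = v' /\ v = u').
Proof.
move=> /fsetP E.
have E' (w : V) : (w == u) || (w == v) = (w == u') || (w == v').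
  by have := E (val w); rewrite !in_fset2 !val_eqE.
have := E' u; rewrite eqxx /= => /esym/orP[]/eqP uu.
- left; split=> //; subst u'.
  have := E' v; rewrite eqxx orbT => /esym/orP[]/eqP //vu; subst v.
  by have := E' v'; rewrite orbb eqxx orbT => /eqP.
- right; split=> //; subst v'.
  have := E' v; rewrite eqxx orbT => /esym/orP[]/eqP //vu; subst v.
  by have := E' u'; rewrite orbb eqxx /= => /eqP.
Qed.

Lemma edgesP g e : e \in edges g -> exists u v : verts g, e = pair_of u v.
Proof.
move=> eg; have := fsubsetP (edges_pairs g) _ eg.
rewrite !inE /= fpowersetE => /andP[eV /eqP e2].
have /fset0Pn[x xe] : e != fset0 by rewrite -cardfs_gt0 e2.
have /eqP/cardfs1P[y ey] : #|` e `\ x| = 1%N.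
  by move: e2; rewrite (cardfsD1 x) xe => -[].
have exy : e = [fset x; y] by rewrite -ey fsetD1K.
have xV : x \in verts g by apply: (fsubsetP eV); rewrite exy !inE eqxx.
have yV : y \in verts g by apply: (fsubsetP eV); rewrite exy !inE eqxx orbT.
by exists [` xV], [` yV].
Qed.

Lemma iso_edge g1 g2 (phi : verts g1 -> verts g2) u v : is_iso phi ->
  (pair_of u v \in edges g1) = (pair_of (phi u) (phi v) \in edges g2).
Proof.
case=> bphi E _ _; apply/idP/idP => uv.
  have: [set` edges g2]%classic (pair_of (phi u) (phi v)) by rewrite E; exists u, v.
  by [].
have: [set` edges g2]%classic (pair_of (phi u) (phi v)) by [].
rewrite E => -[u' [v' [uv' /pair_of_inj]]].
by case=> -[/(bij_inj bphi)-> /(bij_inj bphi)->] //; rewrite pair_ofC.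
Qed.

Lemma is_isoP g1 g2 (phi : verts g1 -> verts g2) : bijective phi ->
  (forall u v, (pair_of u v \in edges g1) = (pair_of (phi u) (phi v) \in edges g2)) ->
  (forall v, vlab v = vlab (phi v)) ->
  (forall u v (uv1 : pair_of u v \in edges g1)
        (uv2 : pair_of (phi u) (phi v) \in edges g2),
        elab [` uv1] = elab [` uv2]) -> is_iso phi.
Proof.
move=> bphi E LV LE; split=> //; apply/seteqP; split=> e /=.
  move=> eg; have [u [v euv]] := edgesP eg; have [psi phiK psiK] := bphi.
  by exists (psi u), (psi v); rewrite E !psiK -euv.
by move=> [u [v [uv ->]]]; rewrite -E.
Qed.

Lemma elab_eq g e e' (eg : e \in edges g) (eg' : e' \in edges g) :
  e = e' -> elab [` eg] = elab [` eg'].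
Proof. by move=> ee; congr elab; apply: val_inj. Qed.

Lemma isomorphic_refl g : isomorphic g g.
Proof.
exists id; apply: is_isoP => //; first by exists id.
by move=> u v uv1 uv2; apply: elab_eq.
Qed.

Lemma isomorphic_sym g1 g2 : isomorphic g1 g2 -> isomorphic g2 g1.
Proof.
case=> phi ip; have [[psi phiK psiK] _ LV LE] := ip; exists psi.
have E u v : (pair_of u v \in edges g2) = (pair_of (psi u) (psi v) \in edges g1).
  by rewrite (iso_edge _ _ ip) !psiK.
apply: is_isoP => //; first by exists phi.
  by move=> v; rewrite LV psiK.
move=> u v uv1 uv2; have uv : pair_of (phi (psi u)) (phi (psi v)) \in edges g2.
  by rewrite !psiK.
by rewrite (LE _ _ _ uv); apply: elab_eq; rewrite !psiK.
Qed.

Lemma isomorphic_trans g1 g2 g3 :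
  isomorphic g1 g2 -> isomorphic g2 g3 -> isomorphic g1 g3.
Proof.
case=> phi ip [psi iq]; have [bp _ LV LE] := ip; have [bq _ LV' LE'] := iq.
exists (psi \o phi); apply: is_isoP => /=; first exact: bij_comp.
- by move=> u v; rewrite (iso_edge _ _ ip) (iso_edge _ _ iq).
- by move=> v; rewrite LV LV'.
- move=> u v uv1 uv3; have uv2 : pair_of (phi u) (phi v) \in edges g2.
    by rewrite -(iso_edge _ _ ip).
  by rewrite (LE _ _ _ uv2).
Qed.

Definition isomorphicb g1 g2 : bool := `[< isomorphic g1 g2 >].

Lemma isomorphicb_refl : reflexive isomorphicb.
Proof. by move=> g; apply/asboolP/isomorphic_refl. Qed.

Lemma isomorphicb_sym : symmetric isomorphicb.
Proof. by move=> g h; apply/asboolP/asboolP => /isomorphic_sym. Qed.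

Lemma isomorphicb_trans : transitive isomorphicb.
Proof.
move=> g h k /asboolP hg /asboolP gk.
by apply/asboolP/(isomorphic_trans hg gk).
Qed.

Canonical isomorphicb_equiv :=
  EquivRel isomorphicb isomorphicb_refl isomorphicb_sym isomorphicb_trans.

End Graphs.

Arguments lgraph : clear implicits.

Definition iso_class (T : choiceType) (SV SE : Type) : Type :=
  {eq_quot @isomorphicb T SV SE}.
HB.instance Definition _ (T : choiceType) (SV SE : Type) :=
  EqQuotient.on (iso_class T SV SE).

Section IsoClasses.
Context {T : choiceType} {SV SE : Type} {R : realType}.
Variables (leV : SV -> SV -> Prop) (leE : SE -> SE -> Prop).
Variables (sV : SV -> R) (sE : SE -> R).

(* Evaluating at representatives is harmless, by class_leE and class_sizeE. *)
Definition class_le (x y : iso_class T SV SE) : Prop :=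
  ext_sub_iso leV leE (repr x) (repr y).

Definition class_size (x : iso_class T SV SE) : R := graph_size sV sE (repr x).

Local Open Scope fset_scope.
Implicit Types g h : lgraph T SV SE.

Lemma isomorphic_size g1 g2 :
  isomorphic g1 g2 -> graph_size sV sE g1 = graph_size sV sE g2.
Proof.
have sizeE g : graph_size sV sE g =
    (\sum_(v : verts g) sV (vlab v) + \sum_(e : edges g) sE (elab e))%R.
  rewrite /graph_size; case: ifP => // /eqP V0.
  rewrite big1 ?add0r ?big1 // => [[e eg] _|[v vg] _].
    by have [v _] := edgesP eg; have : val v \in fset0 by rewrite -V0; apply: valP.
  by have : v \in fset0 by rewrite -V0.
rewrite !sizeE => -[phi ip]; have [bp _ LV LE] := ip; congr (_ + _)%R.
  rewrite (reindex phi); last exact/onW_bij.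
  by apply: eq_bigr => v _; rewrite LV.
have ex (e : edges g1) : exists e' : edges g2, exists u v,
    val e = pair_of u v /\ val e' = pair_of (phi u) (phi v).
  have [u [v euv]] := edgesP (valP e).
  have uv : pair_of (phi u) (phi v) \in edges g2.
    by rewrite -(iso_edge _ _ ip) -euv; apply: valP.
  by exists [` uv], u, v.
have [F FP] := choice ex.
have labF e : elab e = elab (F e).
  have [u [v [e1 e2]]] := FP e.
  case: e (F e) e1 e2 => [e eg] [e' eg'] /= e1 e2; subst e e'; exact: LE.
rewrite (reindex F); first by apply: eq_bigr => e _; rewrite labF.
apply: onW_bij; apply: inj_card_bij.
  move=> e f; have [u [v [e1 e2]]] := FP e; have [u' [v' [f1 f2]]] := FP f.
  move=> ef; apply: val_inj; rewrite e1 f1.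
  have: pair_of (phi u) (phi v) = pair_of (phi u') (phi v') by rewrite -e2 -f2 ef.
  by case/pair_of_inj => -[/(bij_inj bp)-> /(bij_inj bp)->] //; rewrite pair_ofC.
have [psi phiK psiK] := bp.
have ex' (e : edges g2) : exists e' : edges g1, F e' = e.
  have [u [v euv]] := edgesP (valP e).
  have uv : pair_of (psi u) (psi v) \in edges g1.
    by rewrite (iso_edge _ _ ip) !psiK -euv; apply: valP.
  exists [` uv]; apply: val_inj; rewrite euv.
  have [u' [v' [/= /pair_of_inj e1 ->]]] := FP [` uv].
  by case: e1 => -[<- <-]; rewrite !psiK // pair_ofC.
have [G GK] := choice ex'.
exact: leq_card (can_inj GK).
Qed.

Lemma repr_pi g : isomorphic (repr (\pi_(iso_class T SV SE) g)) g.
Proof.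
have: repr (\pi_(iso_class T SV SE) g) = g %[mod iso_class T SV SE] by rewrite reprK.
by move/eqquotP/asboolP.
Qed.

Lemma class_sizeE g :
  class_size (\pi_(iso_class T SV SE) g) = graph_size sV sE g.
Proof.
exact/isomorphic_size/repr_pi.
Qed.

Lemma extended_subgraph_iso h k k' : extended_subgraph leV leE h k ->
  isomorphic k k' -> ext_sub_iso leV leE h k'.
Proof.
move=> [Vhk Ehk lVhk lEhk] [phi ip]; have [bp _ LV LE] := ip.
have phi_inj := bij_inj bp.
pose f (v : verts h) : T := val (phi [` fsubsetP Vhk _ (valP v)]).
have f_inj : injective f.
  by move=> u v /val_inj/phi_inj/(congr1 val) /= /val_inj.
pose V' := [fset f v | v : verts h].
have fV v : f v \in V' by apply/imfsetP; exists v.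
pose F v : V' := [` fV v].
pose E' := [fset e in pairs V' | `[< exists u v : verts h,
    pair_of u v \in edges h /\ e = pair_of (F u) (F v) >] ].
have E'V : E' `<=` pairs V' by apply/fsubsetP => e; rewrite !inE => /andP[].
have exV (w : V') : exists v, F v = w.
  have /imfsetP[v _ wv] := valP w; exists v; exact: val_inj.
have exE (e : E') : exists e' : edges h, exists u v : verts h,
    val e' = pair_of u v /\ val e = pair_of (F u) (F v).
  have := valP e; rewrite !inE => /andP[_ /asboolP[u [v [uv ->]]]].
  by exists [` uv], u, v.
have [G GK] := choice exV; have [H HP] := choice exE.
have F_inj : injective F by move=> u v /(congr1 val)/f_inj.
have FK : cancel F G by move=> v; apply: F_inj; rewrite GK.
pose h' := LGraph E'V (fun w => vlab (G w)) (fun e => elab (H e)).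
have EE' (u v : verts h) : (pair_of u v \in edges h) = (pair_of (F u) (F v) \in E').
  apply/idP/idP => [uv|].
    rewrite in_fset inE; apply/andP; split; last by apply/asboolP; exists u, v.
    have := fsubsetP (edges_pairs h) _ uv.
    rewrite !inE /= !fpowersetE => /andP[_]; rewrite !cardfs2 val_eqE => uv2.
    apply/andP; split; last by rewrite -(inj_eq f_inj) in uv2.
    by apply/fsubsetP => x; rewrite in_fset2 => /orP[]/eqP->; apply: fV.
  rewrite in_fset inE => /andP[_ /asboolP[u' [v' [uv']]]].
  by move=> /pair_of_inj[] [/F_inj-> /F_inj->] //; rewrite pair_ofC.
exists h'.
  exists (F : verts h -> verts h'); apply: is_isoP => //=.
  - by exists G.
  - by move=> v; rewrite FK.
  - move=> u v uv1 uv2; have [u' [v' [e1 /= e2]]] := HP [` uv2].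
    congr elab; apply: val_inj; rewrite e1 /=.
    by case/pair_of_inj : e2 => -[/F_inj-> /F_inj->] //; rewrite pair_ofC.
have Fk (v : verts h) (vk : f v \in verts k') :
    [` vk] = phi [` fsubsetP Vhk _ (valP v)] by exact: val_inj.
have pairk (u v : verts h) : pair_of (F u) (F v) =
   pair_of (phi [` fsubsetP Vhk _ (valP u)]) (phi [` fsubsetP Vhk _ (valP v)]).
  by [].
have Ekk u v : pair_of u v \in edges h ->
    pair_of [` fsubsetP Vhk _ (valP u)] [` fsubsetP Vhk _ (valP v)] \in edges k.
  by move=> /(fsubsetP Ehk); rewrite in_fsetI => /andP[].
split.
- by apply/fsubsetP => _ /imfsetP[v _ ->]; apply: valP.
- apply/fsubsetP => e eE; rewrite in_fsetI (fsubsetP E'V _ eE) andbT.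
  move: eE; rewrite !inE => /andP[_ /asboolP[u [v [uv ->]]]].
  by rewrite pairk -(iso_edge _ _ ip); apply: Ekk.
- move=> w wh wk /=; have := GK [` wh]; move: (G _) => v /(congr1 val) /= fw.
  subst w; rewrite Fk -LV.
  have := lVhk _ (valP v) (fsubsetP Vhk _ (valP v)).
  by congr leV; congr vlab; apply: val_inj.
- move=> e eh ek /=; have [u [v [e1 /= e2]]] := HP [` eh]; subst e.
  have uv : pair_of u v \in edges h by rewrite -e1; apply: valP.
  have := lEhk _ uv (Ekk _ _ uv).
  rewrite (LE _ _ (Ekk _ _ uv) ek); congr leE.
  by congr elab; apply: val_inj.
Qed.

Lemma ext_sub_iso_iso g g' h h' : isomorphic g g' -> isomorphic h h' ->
  ext_sub_iso leV leE g h -> ext_sub_iso leV leE g' h'.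
Proof.
move=> gg' hh' [k gk kh]; have [k' kk' k'h'] := extended_subgraph_iso kh hh'.
exists k' => //; apply: isomorphic_trans kk'; apply: isomorphic_trans gk.
exact: isomorphic_sym.
Qed.

Lemma class_leE g h :
  class_le (\pi_(iso_class T SV SE) g) (\pi_(iso_class T SV SE) h) <->
  ext_sub_iso leV leE g h.
Proof.
split; apply: ext_sub_iso_iso; by [exact: repr_pi|exact/isomorphic_sym/repr_pi].
Qed.

End IsoClasses.

(* Main.v *)
Require Import Defs.
From mathcomp Require Import all_boot all_order all_algebra reals.
From mathcomp Require Import finmap generic_quotient boolp classical_sets.

(* The relation h <=_e g amounts to a pair of label-decreasing injections from
   the vertices and edges of h to those of g, so sizes are compared by
   reindexing sums; positivity of the label sizes makes a size-preserving
   embedding surjective, hence an isomorphism, and this also gives antisymmetry.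
   For (A1), a common subgraph is dominated by the one obtained by relabelling it
   with maximum common sublabels, and the relabelled ones have finitely many
   sizes. For (A2), two extended subgraphs of g are amalgamated over their
   intersection, labelled by (A2) for the labels, and the inequality holds term
   by term over the vertices and edges of g. *)

Set Implicit Arguments.
Unset Strict Implicit.
Unset Printing Implicit Defensive.

Import Order.TTheory GRing.Theory Num.Theory.

Local Open Scope ring_scope.
Local Open Scope quotient_scope.

(** * Sums over finite types compared along injections *)

Section FiniteSums.
Context {R : realType}.

Lemma sum_inj_split (A B : finType) (f : A -> B) (t : B -> R) : injective f ->
  \sum_b t b = \sum_a t (f a) + \sum_(b | b \notin f @: predT) t b.
Proof.
move=> f_inj; rewrite (bigID [in f @: predT]) /=; congr (_ + _).
by rewrite big_imset //; exact: in2W.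
Qed.

Lemma ler_sum_inj (A B : finType) (f : A -> B) (s : A -> R) (t : B -> R) :
  injective f -> (forall b, 0 <= t b) -> (forall a, s a <= t (f a)) ->
  \sum_a s a <= \sum_b t b.
Proof.
move=> f_inj t0 st; rewrite (sum_inj_split _ f_inj) -[leLHS]addr0.
by apply: lerD; [exact: ler_sum|exact: sumr_ge0].
Qed.

(** The difference of the two sums consists of the gaps [t (f a) - s a] and the values of [t] off
    the image of [f]. All are nonnegative, so all vanish, and strict positivity leaves no index off
    the image. *)
Lemma eqr_sum_inj (A B : finType) (f : A -> B) (s : A -> R) (t : B -> R) :
  injective f -> (forall b, 0 < t b) -> (forall a, s a <= t (f a)) ->
  \sum_a s a = \sum_b t b ->
  (forall a, s a = t (f a)) /\ (forall b, exists a, f a = b).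
Proof.
move=> f_inj t0 st /eqP.
rewrite (sum_inj_split _ f_inj) eq_sym -subr_eq0 addrAC -sumrB.
rewrite paddr_eq0; last 2 first.
- by apply: sumr_ge0 => a _; rewrite subr_ge0.
- by apply: sumr_ge0 => b _; exact: ltW.
move=> /andP[/eqP ts0 /eqP tb0]; split=> [a|b].
  apply/esym/eqP; rewrite -subr_eq0; apply/eqP.
  by apply: (psumr_eq0P _ ts0) => // i _; rewrite subr_ge0.
have [/imsetP[a _ ->]|bf] := boolP (b \in f @: predT); first by exists a.
have := psumr_eq0P (fun i _ => ltW (t0 i)) tb0 bf.
by move=> tb; have := t0 b; rewrite tb ltxx.
Qed.

(** [A12] plays the fibre product of [f1] and [f2], that is, the intersection of two subsets of [A].
    Grouping every sum by its image in [A] reduces the claim to one inequality per [w], since each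
    fibre has at most one element. *)
Lemma ler_sum_pullback (A1 A2 A12 A : finType)
    (f1 : A1 -> A) (f2 : A2 -> A) (g1 : A12 -> A1) (g2 : A12 -> A2)
    (s1 : A1 -> R) (s2 : A2 -> R) (s12 : A12 -> R) (s : A -> R) :
  injective f1 -> injective f2 -> injective g1 ->
  (forall c, f1 (g1 c) = f2 (g2 c)) ->
  (forall a b, f1 a = f2 b -> exists c, g1 c = a) ->
  (forall a, 0 <= s a) ->
  (forall a, s1 a <= s (f1 a)) -> (forall b, s2 b <= s (f2 b)) ->
  (forall c, s1 (g1 c) + s2 (g2 c) - s12 c <= s (f1 (g1 c))) ->
  \sum_a s1 a + \sum_b s2 b - \sum_c s12 c <= \sum_w s w.
Proof.
move=> f1_inj f2_inj g1_inj fg pb s0 s1s s2s s12s.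
have fib (B : finType) (f : B -> A) (t : B -> R) :
    \sum_b t b = \sum_w \sum_(b | f b == w) t b.
  exact: (partition_big f predT).
rewrite (fib _ f1 s1) (fib _ f2 s2) (fib _ (f1 \o g1) s12) -big_split -sumrB /=.
apply: ler_sum => w _.
have fib1 (B : finType) (f : B -> A) (t : B -> R) b : injective f ->
    f b = w -> \sum_(b | f b == w) t b = t b.
  by move=> f_inj <-; apply: big_pred1 => x /=; rewrite (inj_eq f_inj).
have fib0 (B : finType) (f : B -> A) (t : B -> R) :
    ~ (exists b, f b = w) -> \sum_(b | f b == w) t b = 0.
  by move=> nb; apply: big1 => b /eqP bw; case: nb; exists b.
have [[c cw]|nc] := pselect (exists c, (f1 \o g1) c = w).
  rewrite (fib1 _ f1 _ (g1 c)) // (fib1 _ f2 _ (g2 c)) //; last by rewrite -fg.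
  by rewrite (fib1 _ (f1 \o g1) _ c) // -?cw; [exact: s12s|exact: inj_comp].
(* By [pb], an index [w] outside the image of [f1 \o g1] cannot lie in the images of both [f1] and
   [f2], so at most one term remains on the left. *)
rewrite (fib0 _ (f1 \o g1)) // subr0.
have [[a aw]|na] := pselect (exists a, f1 a = w).
  rewrite (fib1 _ f1 _ a) // (fib0 _ f2) ?addr0 -?aw // => -[b bw].
  have [|c ca] := pb a b; first by rewrite bw.
  by apply: nc; exists c; rewrite /= ca.
rewrite (fib0 _ f1) // add0r.
have [[b bw]|nb] := pselect (exists b, f2 b = w).
  by rewrite (fib1 _ f2 _ b) // -bw.
by rewrite (fib0 _ f2).
Qed.

(** The set [A] may be infinite: it is enough that finitely many of its elements dominate all the
    others. *)
Lemma has_maximum_finite (D : finType) (m : D -> R) (A : set R) :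
  (A !=set0)%classic -> (forall a, A a -> exists2 d, A (m d) & a <= m d) ->
  has_maximum A.
Proof.
move=> [a0 /[swap] Am /Am[d0 /asboolP Ad0 _]].
case: (@arg_maxP _ _ _ d0 (fun d => `[< A (m d) >]) m Ad0) => d /asboolP Ad dmax.
by exists (m d) => // a /Am[d' /asboolP Ad' /le_trans]; apply; exact: dmax.
Qed.

End FiniteSums.

(** * Common subelements of labels *)

Section MCSLabels.
Context {R : realType} {X : Type} {le : X -> X -> Prop} {s : X -> R}.

Lemma cs2E x1 x2 x : cs le [set x1; x2]%classic x <-> le x x1 /\ le x x2.
Proof.
split=> [csx|[x1x x2x] y [->|->]] //.
by split; apply: csx; [left|right].
Qed.

Hypothesis mcs : mcs_model le s.

(** Choice turns (A1) into a function, so that all vertices or all edges of a graph can be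
    relabelled at once. *)
Lemma mcs_max_choice : exists m : X * X -> X, forall x1 x2,
  [/\ le (m (x1, x2)) x1, le (m (x1, x2)) x2 &
    forall x, le x x1 -> le x x2 -> s x <= s (m (x1, x2))].
Proof.
have /choice[m mP] (p : X * X) : exists x, [/\ le x p.1, le x p.2 &
    forall y, le y p.1 -> le y p.2 -> s y <= s x].
  have [_ [_ [x /cs2E[x1 x2] <-] xmax]] := mcs_max mcs p.1 p.2.
  by exists x; split=> // y y1 y2; apply: xmax; exists y => //; apply/cs2E.
by exists m => x1 x2; exact: (mP (x1, x2)).
Qed.

End MCSLabels.

(** * Extended subgraphs up to isomorphism, as embeddings *)

Section Embeddings.
Local Open Scope fset_scope.
Context {T : choiceType} {SV SE : Type}.
Variables (leV : SV -> SV -> Prop) (leE : SE -> SE -> Prop).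
Implicit Types g h k : lgraph T SV SE.

(** The edge map is kept as separate data, although [f] determines it, so that sums over edges can
    be reindexed along it. *)
Definition embedding h g (f : verts h -> verts g) (F : edges h -> edges g) :=
  [/\ injective f,
      forall e u v, val e = pair_of u v -> val (F e) = pair_of (f u) (f v),
      forall v, leV (vlab v) (vlab (f v)) &
      forall e, leE (elab e) (elab (F e))].

Lemma embedding_edge_inj h g (f : verts h -> verts g) (F : edges h -> edges g) :
  embedding f F -> injective F.
Proof.
move=> [f_inj Ff _ _] e1 e2 /(congr1 val).
have [u1 [v1 e1E]] := edgesP (valP e1); have [u2 [v2 e2E]] := edgesP (valP e2).
rewrite (Ff _ _ _ e1E) (Ff _ _ _ e2E) => uv; apply: val_inj; rewrite e1E e2E.
by case: (pair_of_inj uv) => -[/f_inj-> /f_inj->] //; rewrite pair_ofC.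
Qed.

Lemma pair_of_pairs (V : {fset T}) (u v : V) : u != v -> pair_of u v \in pairs V.
Proof.
move=> uv; rewrite !inE /= fpowersetE cardfs2 val_eqE uv andbT.
by apply/fsubsetP => x; rewrite in_fset2 => /orP[]/eqP->; exact: valP.
Qed.

Lemma edge_neq g (u v : verts g) : pair_of u v \in edges g -> u != v.
Proof.
move=> /(fsubsetP (edges_pairs g)); rewrite !inE /= cardfs2 val_eqE => /andP[_].
by case: (u != v).
Qed.

Lemma ext_sub_iso_embedding h g : ext_sub_iso leV leE h g ->
  exists f F, embedding (h := h) (g := g) f F.
Proof.
move=> [k [phi ip] [Vkg Ekg lVkg lEkg]]; have [/bij_inj phi_inj _ LV LE] := ip.
pose f v := fincl Vkg (phi v).
(* The endpoints of an edge are only known to exist, hence the choice; the property covers every way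
   of writing [e] as a pair. *)
have /choice[F FP] (e : edges h) : exists e' : edges g,
    (forall u v, val e = pair_of u v -> val e' = pair_of (f u) (f v)) /\
    leE (elab e) (elab e').
  have [u [v uv]] := edgesP (valP e).
  have uvh : pair_of u v \in edges h by rewrite -uv; exact: valP.
  have uvk : pair_of (phi u) (phi v) \in edges k by rewrite -(iso_edge _ _ ip).
  have uvg : pair_of (f u) (f v) \in edges g.
    by move: (fsubsetP Ekg _ uvk); rewrite in_fsetI => /andP[].
  exists [` uvg]; split=> [u' v'|].
    by rewrite uv /= => /pair_of_inj[] [-> ->] //; rewrite pair_ofC.
  have -> : e = [` uvh] by exact: val_inj.
  by rewrite (LE _ _ _ uvk); exact: lEkg.
exists f, F; split=> [u v /fincl_inj/phi_inj //|e|v|e]; try by case: (FP e).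
by rewrite LV /f; case: (phi v) => x xk; exact: lVkg.
Qed.

(** The intermediate graph is the image of [h] in [g], carrying the labels of [h] transported along
    the inverses of the corestricted maps. *)
Lemma embedding_ext_sub_iso h g f F : embedding (h := h) (g := g) f F ->
  ext_sub_iso leV leE h g.
Proof.
move=> emb; have F_inj := embedding_edge_inj emb; have [f_inj Ff LV LE] := emb.
pose V' := [fset val (f v) | v : verts h].
pose E' := [fset val (F e) | e : edges h].
have fV v : val (f v) \in V' by apply/imfsetP; exists v.
have FE e : val (F e) \in E' by apply/imfsetP; exists e.
pose phi v : V' := [` fV v].
have phi_inj : injective phi by move=> u v /(congr1 val) /= /val_inj/f_inj.
have E'V : E' `<=` pairs V'.
  apply/fsubsetP => _ /imfsetP[e _ ->]; have [u [v uv]] := edgesP (valP e).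
  rewrite (Ff _ _ _ uv); apply: (@pair_of_pairs V' (phi u) (phi v)).
  by rewrite (inj_eq phi_inj); apply: edge_neq; rewrite -uv; exact: valP.
have /choice[psi psiK] (w : V') : exists v, phi v = w.
  by have /imfsetP[v _ wv] := valP w; exists v; exact: val_inj.
have /choice[G GK] (e : E') : exists e', [` FE e'] = e.
  by have /imfsetP[e' _ ee'] := valP e; exists e'; exact: val_inj.
have phiK : cancel phi psi by move=> v; apply: phi_inj; rewrite psiK.
have FK e : G [` FE e] = e by apply/F_inj/val_inj; have /(congr1 val) := GK [` FE e].
exists (LGraph E'V (fun w => vlab (psi w)) (fun e => elab (G e))).
  exists (phi : _ -> verts (LGraph E'V _ _)); apply: is_isoP => /=.
  - by exists psi.
  - move=> u v; apply/idP/idP => [uv|/imfsetP[e _ uvE]].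
      by have := FE [` uv]; rewrite (Ff [` uv] u v).
    have [u' [v' uv']] := edgesP (valP e).
    have {}uvE : pair_of (f u) (f v) = val (F e) by [].
    move: uvE; rewrite (Ff _ _ _ uv') => /pair_of_inj E.
    suff -> : pair_of u v = val e by exact: valP.
    rewrite uv'.
    by case: E => -[/f_inj-> /f_inj->] //; rewrite pair_ofC.
  - by move=> v; rewrite phiK.
  - move=> u v uv uv'; have -> : [` uv'] = [` FE [` uv]].
      by apply: val_inj; rewrite /= (Ff [` uv] u v).
    by rewrite FK.
split=> /=.
- by apply/fsubsetP => _ /imfsetP[v _ ->]; exact: valP.
- apply/fsubsetP => e eE; rewrite in_fsetI (fsubsetP E'V _ eE) andbT.
  by case/imfsetP : eE => e' _ ->; exact: valP.
- move=> w wh wg; have /(congr1 val) /= := psiK [` wh].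
  by move: (psi _) => v vw; have -> : [` wg] = f v by exact: val_inj.
- move=> e eh eg; have /(congr1 val) /= := GK [` eh].
  by move: (G _) => e' ee'; have -> : [` eg] = F e' by exact: val_inj.
Qed.

Lemma embedding_iso h g f F : embedding (h := h) (g := g) f F ->
  (forall v, vlab v = vlab (f v)) -> (forall e, elab e = elab (F e)) ->
  (forall w, exists v, f v = w) -> (forall e, exists e', F e' = e) ->
  isomorphic h g.
Proof.
move=> [f_inj Ff _ _] LV LE /choice[f' fK] Fsurj.
exists f; apply: is_isoP => //.
- by exists f' => // v; apply: f_inj; rewrite fK.
- move=> u v; apply/idP/idP => uv.
    by have := Ff [` uv] u v erefl => /= <-; exact: valP.
  (* Surjectivity on edges is what makes [f] reflect adjacency: the edge found above [uv] must join
     [u] and [v], as [f] is injective. *)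
  have [e /(congr1 val)] := Fsurj [` uv].
  have [u' [v' uv']] := edgesP (valP e); rewrite (Ff _ _ _ uv') => /pair_of_inj E.
  suff <- : val e = pair_of u v by exact: valP.
  by rewrite uv'; case: E => -[/f_inj-> /f_inj->] //; rewrite pair_ofC.
- move=> u v uv uv'; rewrite LE; congr elab; apply: val_inj => /=.
  exact: (Ff [` uv]).
Qed.

Lemma extended_subgraph_refl g :
  (forall x, leV x x) -> (forall x, leE x x) -> extended_subgraph leV leE g g.
Proof.
move=> Vr Er; split=> // [|v v1 v2|e e1 e2].
- by rewrite fsubsetI fsubset_refl edges_pairs.
- by rewrite (_ : [` v1] = [` v2]) //; exact: val_inj.
- by rewrite (_ : [` e1] = [` e2]) //; exact: val_inj.
Qed.

Lemma embedding_comp h g k f F f' F' :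
  (forall x y z, leV x y -> leV y z -> leV x z) ->
  (forall x y z, leE x y -> leE y z -> leE x z) ->
  embedding (h := h) (g := g) f F -> embedding (h := g) (g := k) f' F' ->
  embedding (f' \o f) (F' \o F).
Proof.
move=> Vt Et [f_inj Ff LV LE] [f'_inj F'f LV' LE']; split=> /=.
- exact: inj_comp.
- by move=> e u v /Ff/F'f.
- by move=> v; exact: Vt (LV v) (LV' _).
- by move=> e; exact: Et (LE e) (LE' _).
Qed.

End Embeddings.

(** * Sizes, common subgraphs and amalgams of graphs *)

Section MCSGraphs.
Local Open Scope fset_scope.
Local Open Scope ring_scope.
Context {R : realType} {T : choiceType} {SV SE : Type}.
Context {leV : SV -> SV -> Prop} {leE : SE -> SE -> Prop}.
Context {sV : SV -> R} {sE : SE -> R}.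
Hypotheses (mcsV : mcs_model leV sV) (mcsE : mcs_model leE sE).
Implicit Types g h : lgraph T SV SE.

Let sV_ge0 x : 0 <= sV x. Proof. exact: size_ge0 (mcs_size mcsV) x. Qed.
Let sE_ge0 x : 0 <= sE x. Proof. exact: size_ge0 (mcs_size mcsE) x. Qed.

Lemma graph_sizeE g : graph_size sV sE g =
  \sum_(v : verts g) sV (vlab v) + \sum_(e : edges g) sE (elab e).
Proof.
rewrite /graph_size; case: ifP => // /eqP V0.
rewrite big1 ?add0r ?big1 // => [[e eg] _|[v vg] _].
  have [v _] := edgesP eg; have : val v \in fset0 by rewrite -V0; exact: valP.
  by [].
by have : v \in fset0 by rewrite -V0.
Qed.

Lemma graph_size_ge0 g : 0 <= graph_size sV sE g.
Proof. by rewrite graph_sizeE; apply: addr_ge0; exact: sumr_ge0. Qed.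

Lemma graph_size_le h g :
  ext_sub_iso leV leE h g -> graph_size sV sE h <= graph_size sV sE g.
Proof.
move=> /ext_sub_iso_embedding[f [F emb]]; have [f_inj _ LV LE] := emb.
rewrite !graph_sizeE; apply: lerD.
  by apply: (ler_sum_inj f_inj) => // v; exact: size_le (mcs_size mcsV) _ _ _.
apply: (ler_sum_inj (embedding_edge_inj emb)) => // e.
exact: size_le (mcs_size mcsE) _ _ _.
Qed.

Lemma graph_size_inj h g : (forall x, 0 < sV x) -> (forall x, 0 < sE x) ->
  ext_sub_iso leV leE h g -> graph_size sV sE h = graph_size sV sE g ->
  isomorphic h g.
Proof.
move=> sV0 sE0 /ext_sub_iso_embedding[f [F emb]]; have [f_inj _ LV LE] := emb.
have F_inj := embedding_edge_inj emb.
have sVf v : sV (vlab v) <= sV (vlab (f v)) by exact: size_le (mcs_size mcsV) _ _ _.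
have sEF e : sE (elab e) <= sE (elab (F e)) by exact: size_le (mcs_size mcsE) _ _ _.
have leVs := ler_sum_inj f_inj (fun w => sV_ge0 (vlab w)) sVf.
have leEs := ler_sum_inj F_inj (fun w => sE_ge0 (elab w)) sEF.
rewrite !graph_sizeE => eqs.
(* The vertex sum and the edge sum both grow weakly along the embedding, so equal totals force
   equality in each of them. *)
have eqV : \sum_(v : verts h) sV (vlab v) = \sum_(v : verts g) sV (vlab v).
  apply/le_anti; rewrite leVs /= -(lerD2r (\sum_(e : edges h) sE (elab e))) eqs.
  by rewrite lerD2l.
move: eqs; rewrite eqV => /addrI eqE.
have [eV surjV] := eqr_sum_inj f_inj (fun w => sV0 (vlab w)) sVf eqV.
have [eE surjE] := eqr_sum_inj F_inj (fun w => sE0 (elab w)) sEF eqE.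
apply: (embedding_iso emb) => //.
- by move=> v; exact: size_inj (mcs_size mcsV) _ _ _ _.
- by move=> e; exact: size_inj (mcs_size mcsE) _ _ _ _.
Qed.

(* d records the images of the pairs of embeddings of h into g1 and g2, which
   determine the size of h relabelled with maximum common sublabels. *)
Lemma graph_max g1 g2 : exists (D : finType) (m : D -> R), forall h,
  ext_sub_iso leV leE h g1 -> ext_sub_iso leV leE h g2 ->
  exists d h', [/\ ext_sub_iso leV leE h' g1, ext_sub_iso leV leE h' g2,
    graph_size sV sE h' = m d & graph_size sV sE h <= m d].
Proof.
have [mV mVP] := mcs_max_choice mcsV; have [mE mEP] := mcs_max_choice mcsE.
pose D : finType := ({set verts g1 * verts g2} * {set edges g1 * edges g2})%type.
exists D, (fun d : D => \sum_(p in d.1) sV (mV (vlab p.1, vlab p.2)) +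
                 \sum_(p in d.2) sE (mE (elab p.1, elab p.2))).
move=> h /ext_sub_iso_embedding[f1 [F1 emb1]] /ext_sub_iso_embedding[f2 [F2 emb2]].
have F1_inj := embedding_edge_inj emb1.
have [f1_inj F1f LV1 LE1] := emb1; have [f2_inj F2f LV2 LE2] := emb2.
exists ((fun v => (f1 v, f2 v)) @: predT, (fun e => (F1 e, F2 e)) @: predT).
exists (LGraph (@edges_pairs _ _ _ h)
  (fun v => mV (vlab (f1 v), vlab (f2 v))) (fun e => mE (elab (F1 e), elab (F2 e)))).
have f_inj : injective (fun v => (f1 v, f2 v)) by move=> u v [/f1_inj].
have F_inj : injective (fun e => (F1 e, F2 e)) by move=> u v [/F1_inj].
(* Both pairings are injective, so the sums over the image sets become sums over the vertices and
   the edges of [h]. *)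
rewrite /= !big_imset /=; [|exact: in2W..].
split.
- apply: (@embedding_ext_sub_iso _ _ _ _ _ (LGraph _ _ _) _ f1 F1); split=> // [v|e].
    by have [] := mVP (vlab (f1 v)) (vlab (f2 v)).
  by have [] := mEP (elab (F1 e)) (elab (F2 e)).
- apply: (@embedding_ext_sub_iso _ _ _ _ _ (LGraph _ _ _) _ f2 F2); split=> // [v|e].
    by have [] := mVP (vlab (f1 v)) (vlab (f2 v)).
  by have [] := mEP (elab (F1 e)) (elab (F2 e)).
- by rewrite graph_sizeE.
- rewrite graph_sizeE; apply: lerD; apply: ler_sum => i _.
    by have [_ _] := mVP (vlab (f1 i)) (vlab (f2 i)); apply.
  by have [_ _] := mEP (elab (F1 i)) (elab (F2 i)); apply.
Qed.

(** Taking actual extended subgraphs of [g], not just graphs isomorphic to such, gives a meaning to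
    the intersection of their vertex and edge sets. *)
Lemma graph_amalgam h1 h2 g :
  extended_subgraph leV leE h1 g -> extended_subgraph leV leE h2 g ->
  exists h, [/\ extended_subgraph leV leE h h1, extended_subgraph leV leE h h2 &
    graph_size sV sE h1 + graph_size sV sE h2 - graph_size sV sE h <=
    graph_size sV sE g].
Proof.
move=> [V1 /[!fsubsetI]/andP[E1 _] LV1 LE1] [V2 /[!fsubsetI]/andP[E2 _] LV2 LE2].
have EV : edges h1 `&` edges h2 `<=` pairs (verts h1 `&` verts h2).
  apply/fsubsetP => e; rewrite in_fsetI => /andP[].
  move=> /(fsubsetP (edges_pairs h1)) + /(fsubsetP (edges_pairs h2)).
  rewrite !inE /= !fpowersetE fsubsetI => /andP[-> ->] /andP[-> _] //.
pose i1 := fincl (fsubsetIl (verts h1) (verts h2)).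
pose i2 := fincl (fsubsetIr (verts h1) (verts h2)).
pose j1 := fincl (fsubsetIl (edges h1) (edges h2)).
pose j2 := fincl (fsubsetIr (edges h1) (edges h2)).
have lV1 v : leV (vlab v) (vlab (fincl V1 v)) by case: v => v vh; exact: LV1.
have lV2 v : leV (vlab v) (vlab (fincl V2 v)) by case: v => v vh; exact: LV2.
have lE1 e : leE (elab e) (elab (fincl E1 e)) by case: e => e eh; exact: LE1.
have lE2 e : leE (elab e) (elab (fincl E2 e)) by case: e => e eh; exact: LE2.
have i12 v : fincl V1 (i1 v) = fincl V2 (i2 v) by exact: val_inj.
have j12 e : fincl E1 (j1 e) = fincl E2 (j2 e) by exact: val_inj.
(* The label in [g] of a shared vertex lies above its labels in [h1] and [h2], which is the
   situation of (A2). *)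
have /choice[lV lVP] v : exists l, [/\ leV l (vlab (i1 v)), leV l (vlab (i2 v)) &
    sV (vlab (i1 v)) + sV (vlab (i2 v)) - sV l <= sV (vlab (fincl V1 (i1 v)))].
  have [|l /cs2E[l1 l2] ls] := mcs_amalgam mcsV (lV1 (i1 v)) (x2 := vlab (i2 v)).
    by rewrite i12.
  by exists l.
have /choice[lE lEP] e : exists l, [/\ leE l (elab (j1 e)), leE l (elab (j2 e)) &
    sE (elab (j1 e)) + sE (elab (j2 e)) - sE l <= sE (elab (fincl E1 (j1 e)))].
  have [|l /cs2E[l1 l2] ls] := mcs_amalgam mcsE (lE1 (j1 e)) (x2 := elab (j2 e)).
    by rewrite j12.
  by exists l.
exists (LGraph EV lV lE); split.
- split=> /= [|||e eh e1].
  + exact: fsubsetIl.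
  + by rewrite fsubsetI fsubsetIl EV.
  + move=> v vh v1; have [+ _ _] := lVP [` vh].
    by rewrite (_ : i1 _ = [` v1]) //; exact: val_inj.
  + have [+ _ _] := lEP [` eh].
    by rewrite (_ : j1 _ = [` e1]) //; exact: val_inj.
- split=> /= [|||e eh e2].
  + exact: fsubsetIr.
  + by rewrite fsubsetI fsubsetIr EV.
  + move=> v vh v2; have [_ + _] := lVP [` vh].
    by rewrite (_ : i2 _ = [` v2]) //; exact: val_inj.
  + have [_ + _] := lEP [` eh].
    by rewrite (_ : j2 _ = [` e2]) //; exact: val_inj.
(* The vertex terms are separated from the edge terms; each half is then a pullback inequality over
   [g]. *)
rewrite !graph_sizeE /= addrACA opprD [leLHS]addrACA; apply: lerD.
  apply: (ler_sum_pullback (f1 := fincl V1) (f2 := fincl V2) (g1 := i1) (g2 := i2)).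
  - exact: fincl_inj.
  - exact: fincl_inj.
  - exact: fincl_inj.
  - exact: i12.
  (* Vertices with the same image in [g] are the same element of [T], hence lie in the
     intersection. *)
  - move=> a b /(congr1 val) ab; have {}ab : val a = val b by [].
    have ah : val a \in verts h1 `&` verts h2 by apply/fsetIP; split; [|rewrite ab]; exact: valP.
    by exists [` ah]; exact: val_inj.
  - by [].
  - by move=> v; exact: size_le (mcs_size mcsV) _ _ _.
  - by move=> v; exact: size_le (mcs_size mcsV) _ _ _.
  - by move=> v; have [] := lVP v.
apply: (ler_sum_pullback (f1 := fincl E1) (f2 := fincl E2) (g1 := j1) (g2 := j2)).
- exact: fincl_inj.
- exact: fincl_inj.
- exact: fincl_inj.
- exact: j12.
- move=> a b /(congr1 val) ab; have {}ab : val a = val b by [].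
  have ah : val a \in edges h1 `&` edges h2 by apply/fsetIP; split; [|rewrite ab]; exact: valP.
  by exists [` ah]; exact: val_inj.
- by [].
- by move=> e; exact: size_le (mcs_size mcsE) _ _ _.
- by move=> e; exact: size_le (mcs_size mcsE) _ _ _.
- by move=> e; have [] := lEP e.
Qed.

End MCSGraphs.

(** * The empty graph, and the passage to isomorphism classes *)

Lemma extended_subgraph_empty (T : choiceType) (SV SE : Type)
    (leV : SV -> SV -> Prop) (leE : SE -> SE -> Prop) :
  exists h : lgraph T SV SE, forall g, extended_subgraph leV leE h g.
Proof.
(* Labellings of the empty graph exist even when the label types are empty. *)
have nolab (K : choiceType) (S : Type) (x : (@fset0 K)) : S by case: x.
exists (LGraph (fsub0set (pairs (@fset0 T))) (nolab _ _) (nolab _ _)) => g.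
by split=> //=; exact: fsub0set.
Qed.

Theorem theorem4 (R : realType) (T : choiceType) (SV SE : Type)
    (leV : SV -> SV -> Prop) (leE : SE -> SE -> Prop)
    (sV : SV -> R) (sE : SE -> R)
    (mcsV : mcs_model leV sV) (mcsE : mcs_model leE sE)
    (sV_gt0 : forall x : SV, 0 < sV x) (sE_gt0 : forall x : SE, 0 < sE x) :
  mcs_model (@class_le T SV SE leV leE) (@class_size T SV SE R sV sE).
Proof.
have [[Vr Vt _] [Er Et _]] := (mcs_order mcsV, mcs_order mcsE).
(* The size function comes before the order, because antisymmetry is derived from (S1) and (S2). *)
have class_sizeP : size_function (@class_le T SV SE leV leE) (class_size sV sE).
  split=> [x|x y|x y xy sxy].
  - exact: graph_size_ge0 mcsV mcsE _.
  - exact: graph_size_le mcsV mcsE _ _.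
  - rewrite -[x]reprK -[y]reprK; apply/eqquotP/asboolP.
    exact: graph_size_inj mcsV mcsE _ _ _ _ xy sxy.
split=> //.
- split=> [x|x y z|x y xy yx].
  + exists (repr x); first exact: isomorphic_refl.
    exact: extended_subgraph_refl.
  + move=> /ext_sub_iso_embedding[f [F fF]] /ext_sub_iso_embedding[f' [F' fF']].
    exact: embedding_ext_sub_iso (embedding_comp Vt Et fF fF').
  (* Each class lies below the other, so (S1) makes the sizes equal and (S2) identifies the
     classes. *)
  + apply: (size_inj class_sizeP) => //.
    by apply/le_anti/andP; split; apply: (size_le class_sizeP).
- elim/quotW=> g1; elim/quotW=> g2.
  have cs0 : (cs (class_le leV leE) [set \pi_(iso_class T SV SE) g1; \pi_(iso_class T SV SE) g2] !=set0)%classic.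
    have [h hg] := extended_subgraph_empty T leV leE.
    exists (\pi_(iso_class T SV SE) h); apply/cs2E; rewrite !class_leE.
    by split; exists h => //; exact: isomorphic_refl.
  split=> //; have [D [m mP]] := graph_max mcsV mcsE g1 g2.
  apply: (@has_maximum_finite _ D m).
    by have [x csx] := cs0; exists (class_size sV sE x); exists x.
  move=> _ [+ + <-]; elim/quotW=> h /cs2E; rewrite !class_leE => -[hg1 hg2].
  have [d [h' [h'1 h'2 h'd hh']]] := mP h hg1 hg2.
  exists d; last by rewrite class_sizeE.
  exists (\pi_(iso_class T SV SE) h'); last by rewrite class_sizeE.
  by apply/cs2E; rewrite !class_leE.
- elim/quotW=> x1; elim/quotW=> x2; elim/quotW=> g.
  (* [x1] and [x2] are replaced by isomorphic copies [h1] and [h2] inside the same [g], which can be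
     amalgamated there. *)
  rewrite !class_leE => -[h1 xh1 h1g] [h2 xh2 h2g].
  have [h [hh1 hh2 sh]] := graph_amalgam mcsV mcsE h1g h2g.
  exists (\pi_(iso_class T SV SE) h); last first.
    by rewrite !class_sizeE (isomorphic_size sV sE xh1) (isomorphic_size sV sE xh2).
  apply/cs2E; rewrite !class_leE.
  split; apply: (ext_sub_iso_iso (isomorphic_refl h)).
  + exact/isomorphic_sym/xh1.
  + by exists h => //; exact: isomorphic_refl.
  + exact/isomorphic_sym/xh2.
  + by exists h => //; exact: isomorphic_refl.
Qed.
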